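(* Let $\{\mathbf{x}^k\}_{k\ge 0}$ and $\{\mathbf{y}^k\}_{k\ge 0}$ be the two sequences generated by the Bi-SG Algorithm (Version II) with parameter $\alpha\in(1/2,1)$. Assume in addition that $\sigma$ is $\beta$-strongly convex for some $\beta>0$, and that $g$ has bounded sub-gradients on bounded subsets of $\mathbb{R}^n$. Let $\mathbf{x}'\in X'$, and let $D$ and $H$ be the associated constants defined in the context. Then for every integer $k\ge1$, $$\varphi(\mathbf{x}^{\tilde k})-\varphi(\mathbf{x}')\le\frac{2H+D^2}{k^\alpha}\qquad\text{and}\qquad\omega(\mathbf{x}^{\tilde k})-\omega(\mathbf{x}')\le\left(\frac{1}{e^{c\beta/4}}\right)^{k^{1-\alpha}}D^2,$$ where $\tilde k\in\arg\min\{\omega(\mathbf{x}^j): k+1\le j\le 2k\}$.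
   Context: Problem. The inner problem is $\min_{\mathbf{x}\in\mathbb{R}^n}\{\varphi(\mathbf{x}):=f(\mathbf{x})+g(\mathbf{x})\}$, where $f:\mathbb{R}^n\to\mathbb{R}$ is convex and continuously differentiable with $L_f$-Lipschitz gradient ($L_f>0$), $g:\mathbb{R}^n\to(-\infty,\infty]$ is proper, lower semicontinuous and convex, and the set $X^*$ of minimizers of $\varphi$ is nonempty. The outer problem is $\min_{\mathbf{x}\in X^*}\omega(\mathbf{x})$, where $\omega:\mathbb{R}^n\to\mathbb{R}$ is convex and coercive ($\omega(\mathbf{x})\to\infty$ as $\|\mathbf{x}\|\to\infty$), and $\omega=\sigma+\psi$ with $\sigma:\mathbb{R}^n\to\mathbb{R}$ convex, continuously differentiable with $L_\sigma$-Lipschitz gradient ($L_\sigma>0$) and $\psi:\mathbb{R}^n\to\mathbb{R}$ proper, lower semicontinuous and convex. $X'$ denotes the set of optimal solutions of the outer problem. The norm $\|\cdot\|$ is the Euclidean norm. Notation. For a smooth convex $s$, a proper lower semicontinuous convex $h$ and $t>0$: $\mathrm{prox}_{th}(\mathbf{x})=\arg\min_{\mathbf{u}}\{t h(\mathbf{u})+\frac12\|\mathbf{u}-\mathbf{x}\|^2\}$, $T_t^{s,h}(\mathbf{x})=\mathrm{prox}_{th}(\mathbf{x}-t\nabla s(\mathbf{x}))$, and the gradient mapping is $G_t^{s,h}(\mathbf{x})=\frac1t(\mathbf{x}-T_t^{s,h}(\mathbf{x}))$. Bi-SG Algorithm (Version II). Input $\alpha$, $0<c\le\min\{1/L_\sigma,1\}$,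 and $\eta_k=c(k+1)^{-\alpha}$. Start from any $\mathbf{x}^0\in\mathbb{R}^n$. For $k=0,1,2,\dots$: $\mathbf{y}^k=T_{t_k}^{f,g}(\mathbf{x}^k)$ with $t_k=1/L_k$, then $\mathbf{x}^{k+1}=\mathrm{prox}_{\eta_k\psi}(\mathbf{y}^k-\eta_k\nabla\sigma(\mathbf{y}^k))=\mathbf{y}^k-\eta_k\Omega_k(\mathbf{y}^k)$, where $\Omega_k=G_{\eta_k}^{\sigma,\psi}$. Step-sizes. Either constant, $L_k=L_f$ for all $k$, in which case $\bar L:=L_f$; or backtracking with parameters $\gamma>0$, $\rho>1$: $L_{-1}=\gamma$ and $L_k=L_{k-1}\rho^{i_k}$, where $i_k$ is the smallest non-negative integer such that, with $t_k=1/L_k$, $f(T_{t_k}^{f,g}(\mathbf{x}^k))\le f(\mathbf{x}^k)+\langle\nabla f(\mathbf{x}^k),T_{t_k}^{f,g}(\mathbf{x}^k)-\mathbf{x}^k\rangle+\frac{L_k}{2}\|T_{t_k}^{f,g}(\mathbf{x}^k)-\mathbf{x}^k\|^2$; in this case $\bar L:=\max\{L_f\rho,\gamma\}$. Constants. For the given $\mathbf{x}'\in X'$, $D_1,D_2>0$ are constants such that for all $k\ge0$: $\|\mathbf{x}^k-\mathbf{x}'\|\le D_1$, $\|\Omega_k(\mathbf{y}^k)\|\le D_2$, and every sub-gradient in $\partial\omega(\mathbf{y}^k)$, and (for $k\ge 1$) in $\partial\omega(\mathbf{x}^k)$ and $\partial\varphi(\mathbf{x}^k)$, has norm at most $D_2$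 (such constants exist under the stated assumptions). Set $D=D_1+D_2$ and, for $\alpha\in(1/2,1)$, $H=D^2\bar L/(1-\alpha)$. *)

(* Defs.v *)
From mathcomp Require Export all_boot all_order all_algebra.
From mathcomp Require Export all_classical all_reals all_analysis.
Export Order.TTheory GRing.Theory Num.Theory.
Export numFieldNormedType.Exports.

Set Implicit Arguments.
Unset Strict Implicit.
Unset Printing Implicit Defensive.

Local Open Scope classical_set_scope.
Local Open Scope ring_scope.

(* The canonical norm [`|x|] on ['rV[R]_n] is
   the sup norm; it is used here only through the topology and the bounded
   sets it induces, which are those of the Euclidean norm [enorm]. *)

Section Euclidean.
Context {R : realType} {n : nat}.
Implicit Types (x y u v xi : 'rV[R]_n) (s : 'rV[R]_n -> R)
  (h : 'rV[R]_n -> \bar R).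

Definition dot u v : R := \sum_i u 0 i * v 0 i.

Definition enorm u : R := Num.sqrt (dot u u).

(* Only meaningful as a gradient where [s] is differentiable. *)
Definition grad s x : 'rV[R]_n := \row_i 'D_(delta_mx 0 i) s x.

Definition continuously_differentiable s : Prop :=
  (forall x, differentiable s x) /\ continuous (grad s).

Definition lipschitz_grad (L : R) s : Prop :=
  forall x y, enorm (grad s x - grad s y) <= L * enorm (x - y).

Definition strongly_convex (beta : R) s : Prop :=
  forall x y (t : R), 0 <= t <= 1 ->
    s (t *: x + (1 - t) *: y) <=
      t * s x + (1 - t) * s y - beta / 2 * t * (1 - t) * enorm (x - y) ^+ 2.

Definition coercive s : Prop :=
  forall M : R, exists r : R, forall x, r <= enorm x -> M <= s x.

Definition proper_function h : Prop :=
  (forall x, h x != -oo%E) /\ exists x, (h x < +oo)%E.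

(* [0 * +oo = 0] in [\bar R], so the cases [t = 0] and [t = 1] are trivial. *)
Definition econvex h : Prop :=
  forall x y (t : R), 0 <= t <= 1 ->
    (h (t *: x + (1 - t) *: y)%R <= t%:E * h x + (1 - t)%:E * h y)%E.

Definition proper_lsc_convex h : Prop :=
  [/\ proper_function h, lower_semicontinuous h & econvex h].

(* For proper [h] this set is empty wherever [h x = +oo]. *)
Definition subdifferential h x : set 'rV[R]_n :=
  [set xi | forall y, (h x + (dot xi (y - x))%:E <= h y)%E].

Definition bounded_subgradients_on_bounded_sets h : Prop :=
  forall A : set 'rV[R]_n, bounded_set A ->
    exists M : R, forall x xi,
      A x -> subdifferential h x xi -> enorm xi <= M.

End Euclidean.

Definition argmin {X : Type} {d : Order.disp_t} {T : porderType d}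
    (h : X -> T) (A : set X) : set X :=
  [set x | A x /\ forall y, A y -> (h x <= h y)%O].

Section Algorithm.
Context {R : realType} {n : nat}.
Implicit Types (s f sigma psi : 'rV[R]_n -> R) (h g : 'rV[R]_n -> \bar R)
  (t : R) (x : 'rV[R]_n).

(* The minimizer is unique when [h] is proper, lower semicontinuous and convex
   and [t > 0]; the default value [0] is then never used. *)
Definition prox t h x : 'rV[R]_n :=
  xget 0 (argmin (fun u => (t%:E * h u + (enorm (u - x) ^+ 2 / 2)%:E)%E) setT).

Definition prox_grad s h t x : 'rV[R]_n := prox t h (x - t *: grad s x).

Definition grad_map s h t x : 'rV[R]_n := t^-1 *: (x - prox_grad s h t x).

Definition sufficient_decrease f g (L : R) x : Prop :=
  let z := prox_grad f g L^-1 x in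
  f z <= f x + dot (grad f x) (z - x) + L / 2 * enorm (z - x) ^+ 2.

Definition previous (gamma : R) (L : nat -> R) (k : nat) : R :=
  if k is k'.+1 then L k' else gamma.

Definition backtracking f g (gamma rho : R) (xs : nat -> 'rV[R]_n)
    (L : nat -> R) : Prop :=
  forall k, exists i : nat,
    [/\ L k = previous gamma L k * rho ^+ i,
        sufficient_decrease f g (L k) (xs k) &
        forall j, (j < i)%N ->
          ~ sufficient_decrease f g (previous gamma L k * rho ^+ j) (xs k)].

Definition stepsize_rule f g (Lf : R) (xs : nat -> 'rV[R]_n) (L : nat -> R)
    (Lbar : R) : Prop :=
  ((forall k, L k = Lf) /\ Lbar = Lf) \/
  (exists gamma rho : R,
     [/\ 0 < gamma, 1 < rho, backtracking f g gamma rho xs L &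
         Lbar = Num.max (Lf * rho) gamma]).

Definition outer_step (c alpha : R) (k : nat) : R :=
  c * k.+1%:R `^ (- alpha).

Definition biSG f g sigma psi (c alpha : R) (L : nat -> R)
    (xs ys : nat -> 'rV[R]_n) : Prop :=
  forall k,
    ys k = prox_grad f g (L k)^-1 (xs k) /\
    xs k.+1 = prox_grad sigma (EFin \o psi) (outer_step c alpha k) (ys k).

End Algorithm.

(* Main.v *)
Require Import Defs.
From mathcomp Require Import all_boot all_order all_algebra.
From mathcomp Require Import all_classical all_reals all_analysis.
From mathcomp Require Import finmap ring lra.

(** The inner step is a proximal gradient step for [phi = f + g], the outer one
    a proximal gradient step for [omega = sigma + psi]. Both rates come from
    the same estimate, [prox_grad_inequality]: a step of length [t] from [x] to
    [z] satisfies, for every [u],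
      [F z <= F u + (|x - u|^2 - |z - u|^2) / (2 t) - b |x - u|^2 / 2],
    where [b] is the modulus of strong convexity of the smooth part. It rests
    on the existence of proximal points (compactness and lower semicontinuity),
    on their optimality condition, on the gradient inequality and on the
    descent lemma.

    Bounded subgradients of [g] on bounded sets force [g] to be finite and
    subdifferentiable everywhere ([bounded_subgradients_neq0]): the proximal
    points of [x] for steps tending to [0] converge to [x] with bounded
    subgradients. So the inner gap is a real number at every [x^k], although the
    outer step disregards the domain of [g], and the bound [D2] controls how
    much an outer step can increase it.

    Inner rate. Let [b_j] be the gap of [phi] at [y^j]. Since [x^(j+1)] is only
    [O(j^(-alpha))] away from [y^j], using as [u] the point
    [w x' + (1 - w) y^j] with [w = (j+1)^(-alpha)] gives
      [b_(j+1) <= (1 - w) b_j + w^2 Lbar D^2 / 2],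
    which implies [b_j = O(j^(-alpha))] for every [j], not just on average or
    for the best iterate ([recursion_rate], [inner_rate]). The last outer step
    adds at most [D2^2 j^(-alpha)].

    Outer rate. If the best iterate of the window is not already below the
    optimal value, then all iterates of the window are above it, and each outer
    step multiplies the squared distance to [x'] by at most
    [1 - beta eta_j <= exp (- beta eta_j)], while the inner steps do not increase
    it because [x'] minimizes [phi]. The outer steps of the window add up to at
    least [c k^(1-alpha) / 2] ([outer_rate]), so the distance at index [2k] is at
    most [exp (- c beta k^(1-alpha) / 4) D1]; a subgradient of [omega] at that
    iterate, of norm at most [D2], converts distance into function value. *)

Import Order.TTheory GRing.Theory Num.Theory.
Set Implicit Arguments.
Unset Strict Implicit.
Unset Printing Implicit Defensive.
Local Open Scope classical_set_scope.
Local Open Scope ring_scope.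

(** * Euclidean inner product, norm and balls *)

Section EuclideanSpace.
Context {R : realType} {n : nat}.
Implicit Types (u v w x y : 'rV[R]_n) (a r : R).

Lemma dotC u v : dot u v = dot v u.
Proof. by apply: eq_bigr => i _; rewrite mulrC. Qed.

Lemma dotDl u v w : dot (u + v) w = dot u w + dot v w.
Proof. by rewrite -big_split; apply: eq_bigr => i _; rewrite mxE mulrDl. Qed.

Lemma dotZl a u v : dot (a *: u) v = a * dot u v.
Proof. by rewrite mulr_sumr; apply: eq_bigr => i _; rewrite mxE mulrA. Qed.

Lemma dotNl u v : dot (- u) v = - dot u v.
Proof. by rewrite -scaleN1r dotZl mulN1r. Qed.

Lemma dotBl u v w : dot (u - v) w = dot u w - dot v w.
Proof. by rewrite dotDl dotNl. Qed.

Lemma dotDr u v w : dot u (v + w) = dot u v + dot u w.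
Proof. by rewrite dotC dotDl !(dotC u). Qed.

Lemma dotZr a u v : dot u (a *: v) = a * dot u v.
Proof. by rewrite dotC dotZl dotC. Qed.

Lemma dotNr u v : dot u (- v) = - dot u v.
Proof. by rewrite dotC dotNl dotC. Qed.

Lemma dotBr u v w : dot u (v - w) = dot u v - dot u w.
Proof. by rewrite dotDr dotNr. Qed.

Lemma dot_ge0 u : 0 <= dot u u.
Proof. by apply: sumr_ge0 => i _; rewrite -expr2 sqr_ge0. Qed.

Lemma enorm_ge0 u : 0 <= enorm u.
Proof. exact: sqrtr_ge0. Qed.

Lemma enorm_sqr u : enorm u ^+ 2 = dot u u.
Proof. by rewrite sqr_sqrtr// dot_ge0. Qed.

Lemma enormZ a u : enorm (a *: u) = `|a| * enorm u.
Proof.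
by rewrite /enorm dotZl dotZr mulrA -expr2 sqrtrM ?sqr_ge0// sqrtr_sqr.
Qed.

Lemma enormN u : enorm (- u) = enorm u.
Proof. by rewrite -scaleN1r enormZ normrN1 mul1r. Qed.

Lemma enormBC u v : enorm (u - v) = enorm (v - u).
Proof. by rewrite -enormN opprB. Qed.

Lemma enorm0 : enorm (0 : 'rV[R]_n) = 0.
Proof. by rewrite -(scale0r 0) enormZ normr0 mul0r. Qed.

Lemma enormD_sqr u v :
  enorm (u + v) ^+ 2 = enorm u ^+ 2 + 2 * dot u v + enorm v ^+ 2.
Proof. by rewrite !enorm_sqr dotDl !dotDr (dotC v u); ring. Qed.

Lemma enormB_sqr u v :
  enorm (u - v) ^+ 2 = enorm u ^+ 2 - 2 * dot u v + enorm v ^+ 2.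
Proof. by rewrite enormD_sqr enormN dotNr; ring. Qed.

Lemma coord_le_enorm u i : `|u 0 i| <= enorm u.
Proof.
rewrite -sqrtr_sqr ler_wsqrtr// /dot (bigD1 i)//= -expr2 lerDl.
by apply: sumr_ge0 => j _; rewrite -expr2 sqr_ge0.
Qed.

Lemma enorm_eq0 u : enorm u = 0 -> u = 0.
Proof.
move=> u0; apply/rowP => i; rewrite mxE; apply/eqP.
by rewrite -normr_le0 -u0 coord_le_enorm.
Qed.

Lemma dot_le_enorm u v : dot u v <= enorm u * enorm v.
Proof.
have [u0|u0] := eqVneq (enorm u) 0.
  by rewrite u0 (enorm_eq0 u0) -(scale0r 0) dotZl !mul0r.
have [v0|v0] := eqVneq (enorm v) 0.
  by rewrite v0 (enorm_eq0 v0) -(scale0r 0) dotZr mulr0 mul0r.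
have uv_gt0 : 0 < enorm u * enorm v by rewrite mulr_gt0// lt0r enorm_ge0 ?u0 ?v0.
have := sqr_ge0 (enorm (enorm v *: u - enorm u *: v)).
rewrite enormB_sqr !enormZ !ger0_norm ?enorm_ge0// dotZl dotZr => h.
rewrite -(ler_pM2l uv_gt0); lra.
Qed.

Lemma ler_enormD u v : enorm (u + v) <= enorm u + enorm v.
Proof.
rewrite -(@ler_pXn2r _ 2)// ?nnegrE ?addr_ge0 ?enorm_ge0// enormD_sqr sqrrD.
have := dot_le_enorm u v; lra.
Qed.

Lemma continuous_enormB x : continuous (fun u => enorm (u - x)).
Proof.
suff cont_sqr : continuous (fun v => dot (v - x) (v - x)).
  move=> u; apply: (@continuous_comp _ _ _ (fun v => dot (v - x) (v - x)) Num.sqrt).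
    exact: cont_sqr.
  exact: sqrt_continuous.
have -> : (fun v => dot (v - x) (v - x)) =
    (fun v => \sum_i (v 0 i - x 0 i) * (v 0 i - x 0 i)).
  by apply/funext => v; apply: eq_bigr => i _; rewrite !mxE.
have ci i : continuous (fun v : 'rV[R]_n => v 0 i - x 0 i).
  by move=> u; apply: continuousB; [exact: coord_continuous|exact: cst_continuous].
have cii i : continuous (fun v : 'rV[R]_n => (v 0 i - x 0 i) * (v 0 i - x 0 i)).
  by move=> u; apply: (@continuousM R _ (fun v : 'rV[R]_n => v 0 i - x 0 i)
    (fun v : 'rV[R]_n => v 0 i - x 0 i)); exact: ci.
apply: continuous_big => [|i _]; first exact: add_continuous.
exact: cii.
Qed.

(** This lemma and [nbhs_eballP] say that Euclidean balls form a basis of the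
    ambient topology, which is generated by the sup norm. *)
Lemma nbhs_eball x e : 0 < e -> nbhs x [set u | enorm (u - x) < e].
Proof.
move=> e0; have := @continuous_enormB x x; rewrite /continuous_at subrr enorm0.
move=> /cvgr_lt /(_ _ e0); exact.
Qed.

Lemma nbhs_eballP x (V : set 'rV[R]_n) : nbhs x V ->
  exists2 e, 0 < e & forall u, enorm (u - x) < e -> V u.
Proof.
move=> /nbhs_ballP[e /= e0 eV]; exists e => // u ux; apply: eV; split=> // i j.
rewrite ord1 /ball/= (le_lt_trans _ ux)// enormBC.
by have := coord_le_enorm (x - u) j; rewrite !mxE.
Qed.

Lemma bounded_eball x r : bounded_set [set u | enorm (u - x) <= r].
Proof.
exists (enorm x + r); split; first exact: num_real.
move=> M ltM u /= ur.
have M_ge : enorm u <= M.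
  rewrite -(subrK x u) (le_trans (ler_enormD _ _))// addrC.
  by rewrite (le_trans _ (ltW ltM))// lerD2l.
rewrite -[X in X <= _]/(mx_norm u) mx_normrE; apply/bigmax_leP; split=> [|[i j] _ /=].
  exact: le_trans (enorm_ge0 u) M_ge.
by rewrite ord1 (le_trans (coord_le_enorm _ _)).
Qed.

Lemma compact_eball x r : compact [set u | enorm (u - x) <= r].
Proof.
apply: bounded_closed_compact; first exact: bounded_eball.
apply: (@preimage_closed _ _ (fun u => enorm (u - x)) [set a | a <= r]).
  by move=> u _; exact: continuous_enormB.
exact: closed_le.
Qed.

End EuclideanSpace.

(** * Gradients of convex and of Lipschitz-smooth functions *)

Section Gradient.
Context {R : realType} {n : nat}.
Implicit Types (s : 'rV[R]_n -> R) (u v x y : 'rV[R]_n).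

Lemma derive_grad s x v : differentiable s x -> 'D_v s x = dot (grad s x) v.
Proof.
move=> ds; rewrite deriveE// [in LHS](row_sum_delta v) linear_sum.
by apply: eq_bigr => i _; rewrite linearZ/= mxE deriveE// mulrC.
Qed.

(** Strong convexity between [x] and [x + h v] bounds the difference quotient
    of [s] at [x] along [v] by [s u - s x - b/2 (1 - h) |v|^2]; the bound
    passes to the limit [h -> 0+]. *)
Lemma strongly_convex_gradient_le s (b : R) x u :
  differentiable s x -> strongly_convex b s ->
  s x + dot (grad s x) (u - x) + b / 2 * enorm (u - x) ^+ 2 <= s u.
Proof.
move=> ds sc; rewrite -derive_grad//; set v := u - x; set N := enorm v ^+ 2.
pose q (h : R) := h^-1 *: ((s \o shift x) (h *: v) - s x).
have cq : q h @[h --> 0^'] --> 'D_v s x by exact: diff_derivable.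
have cp : q h - b / 2 * h * N @[h --> 0^'+] --> 'D_v s x - b / 2 * 0 * N.
  apply: cvgB.
    apply: cvg_trans cq; apply: cvg_app => A [e e0 Ae]; exists e => // h he h0.
    by apply: Ae => //; exact: lt0r_neq0.
  apply: cvgMl; apply: cvgMr; apply: cvg_at_right_filter; exact: cvg_id.
suff : 'D_v s x - b / 2 * 0 * N <= s u - s x - b / 2 * N by lra.
apply: (cvgr_to_le cp); near=> h.
have h0 : 0 < h by near: h; exact: nbhs_right_gt.
have h1 : h <= 1 by near: h; exact: nbhs_right_le.
have := sc u x h; rewrite (ltW h0) h1 => /(_ isT).
have -> : h *: u + (1 - h) *: x = h *: v + x.
  by rewrite scalerBr scalerBl scale1r [_ - _]addrC addrA.
rewrite -/v -/N => le_sc.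
suff : q h <= s u - s x - b / 2 * (1 - h) * N by lra.
rewrite /q -[_ *: _]/(_ * _) mulrC ler_pdivrMr//=; lra.
Unshelve. all: by end_near. Qed.

(** Lets one gradient inequality serve both the convex inner objective and the
    strongly convex outer one. *)
Lemma convex_strongly_convex0 s : convex_function setT s -> strongly_convex 0 s.
Proof.
move=> sc x y t /andP[t0 t1].
have := sc (Itv01 t0 t1) x y (mem_setT _) (mem_setT _).
by rewrite !mul0r subr0.
Qed.

Lemma convex_gradient_le s x u :
  differentiable s x -> convex_function setT s ->
  s x + dot (grad s x) (u - x) <= s u.
Proof.
move=> ds /convex_strongly_convex0 /(strongly_convex_gradient_le u ds).
by rewrite !mul0r addr0.
Qed.

(** Subtracting the quadratic model from [s] along the segment from [x] to [z]
    leaves a function whose derivative is nonpositive, by Cauchy-Schwarz and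
    the Lipschitz bound on the gradient; the mean value theorem concludes
    without integrating. *)
Lemma descent_lemma s (L : R) x z :
  (forall y, differentiable s y) -> lipschitz_grad L s ->
  s z <= s x + dot (grad s x) (z - x) + L / 2 * enorm (z - x) ^+ 2.
Proof.
move=> ds sL; set v := z - x; set N := enorm v ^+ 2.
pose m (t : R) := s (x + t *: v) - t * dot (grad s x) v - L / 2 * N * t ^+ 2.
pose dm (t : R) := dot (grad s (x + t *: v) - grad s x) v - L * N * t.
have dmP (t : R) : is_derive t 1 m (dm t).
  have d1 : is_derive t 1 (fun t : R => s (x + t *: v))
      (dot (grad s (x + t *: v)) v).
    have E : (fun h : R => h^-1 *: (((fun t : R => s (x + t *: v)) \o shift t)
          (h *: 1) - s (x + t *: v))) =
        (fun h : R => h^-1 *: ((s \o shift (x + t *: v)) (h *: v) - s (x + t *: v))).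
      apply/funext => h /=; congr (_ *: (s _ - _)).
      by rewrite [_%:A]mulr1 scalerDl addrCA.
    rewrite -derive_grad//; split; rewrite /derivable /derive E//.
    exact: diff_derivable.
  have -> : m = (fun t : R => s (x + t *: v)) - dot (grad s x) v \*: id -
      (L / 2 * N) \*: (id ^+ 2).
    by apply/funext => r; rewrite /m !fctE /= [_ *: r]mulrC.
  apply: is_derive_eq; rewrite /dm dotBl /= expr1.
  set a := dot _ _; set b := dot _ _; rewrite /GRing.scale /=; lra.
have mc : {within `[0, 1], continuous m}.
  apply: derivable_within_continuous => t _; exact: ex_derive.
have [t t01] := MVT ltr01 (fun t _ => dmP t) mc.
rewrite subr0 mulr1 => mE.
have : dm t <= 0.
  move: t01; rewrite in_itv/= => /andP[t0 t1].
  have := sL (x + t *: v) x; rewrite [_ - x]addrAC subrr add0r enormZ.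
  rewrite (ger0_norm (ltW t0)) => h.
  rewrite /dm subr_le0 (le_trans (dot_le_enorm _ _))//.
  rewrite (le_trans (ler_wpM2r (enorm_ge0 v) h))// /N expr2.
  by rewrite le_eqVlt; apply/orP; left; apply/eqP; ring.
rewrite -mE /m scale1r scale0r addr0 /v subrKC expr0n/= expr1n -/v; lra.
Qed.

End Gradient.

(** * Existence and optimality of proximal points *)

Section Prox.
Context {R : realType} {n : nat}.
Implicit Types (h : 'rV[R]_n -> \bar R) (u v x y p : 'rV[R]_n) (t a b : R).

(** If no point of [K] were a minimizer, the open sets [F > F y] for [y] in [K]
    would cover [K]. In a finite subcover the center with the smallest value
    is covered by none of the sets, a contradiction. *)
Lemma lsc_compact_argmin (F : 'rV[R]_n -> \bar R) (K : set 'rV[R]_n) :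
  lower_semicontinuous F -> compact K -> K !=set0 -> argmin F K !=set0.
Proof.
move=> /lower_semicontinuousP lscF cK [x0 Kx0]; apply: contrapT => noargmin.
have better x : K x -> exists2 y, K y /\ F y \is a fin_num & (F y < F x)%E.
  have smaller z : K z -> exists2 y, K y & (F y < F z)%E.
    move=> Kz; apply: contrapT => noy; apply: noargmin; exists z; split=> // y Ky.
    by rewrite leNgt; apply/negP => Fyz; apply: noy; exists y.
  move=> /smaller[y Ky Fyx]; exists y => //; split=> //.
  rewrite fin_numE (lt_eqF (lt_le_trans Fyx (leey _))) andbT.
  have [z _ Fzy] := smaller _ Ky; by rewrite gt_eqF// (le_lt_trans (leNye _) Fzy).
move: cK; rewrite compact_cover => /(_ _ [set y | K y /\ F y \is a fin_num]
  (fun y => [set x | (F y < F x)%E])).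
case=> [y [_ /fineK <-]|x /better[y ? ?]|D' D'K D'cover]; [exact: lscF|by exists y|].
have [y0 /= D'y0 _] := D'cover _ Kx0.
pose z := [arg min_(i < [` D'y0]%fset) fine (F (val i))]%O.
have zmin (i : D') : fine (F (val z)) <= fine (F (val i)).
  by rewrite /z; case: arg_minP => //= j _; exact.
have /set_mem[Kz Fz] := D'K _ (valP z).
have [y /= D'y] := D'cover _ Kz; rewrite ltNge => /negP; apply.
have /set_mem[_ Fy] := D'K _ D'y.
by rewrite -(fineK Fz) -(fineK Fy) lee_fin (zmin [` D'y]%fset).
Qed.

(** On the unit ball around [x0] the function is bounded below because it is
    lower semicontinuous; outside, convexity along the ray from [x0] turns
    that bound into one that decreases at most linearly in the distance. *)
Lemma proper_lsc_convex_minorant h x0 a : proper_lsc_convex h -> h x0 = a%:E ->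
  exists2 A, 0 <= A & forall u, ((a - A * (1 + enorm (u - x0)))%:E <= h u)%E.
Proof.
move=> [[hNy _] lsch ch] hx0.
have x0K : enorm (x0 - x0) <= 1 by rewrite subrr enorm0 ler01.
have [p [_ pmin]] := lsc_compact_argmin lsch (@compact_eball _ _ x0 1)
  (ex_intro _ x0 x0K).
have /fineK hpE : h p \is a fin_num.
  by rewrite fin_numE hNy lt_eqF// (le_lt_trans (pmin _ x0K))// hx0 ltry.
set m := fine (h p) in hpE; have ma : m <= a.
  by rewrite -lee_fin -hx0 hpE pmin.
exists (a - m) => [|u]; first by rewrite subr_ge0.
have := hNy u; case hu: (h u) => [b| |]// _; last by rewrite leey.
rewrite lee_fin; set r := enorm (u - x0).
have r0 : 0 <= r := enorm_ge0 _.
have [r1|r1] := leP r 1.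
  have : m <= b by rewrite -lee_fin -hu hpE pmin.
  have : 0 <= (a - m) * r by rewrite mulr_ge0// subr_ge0.
  lra.
have r_gt0 : 0 < r by lra.
have t01 : 0 <= r^-1 <= 1 by rewrite invr_ge0 r0 invf_le1// ltW.
have wE : r^-1 *: u + (1 - r^-1) *: x0 - x0 = r^-1 *: (u - x0).
  by rewrite scalerBl scale1r scalerBr addrA addrAC addrK.
have := pmin (r^-1 *: u + (1 - r^-1) *: x0).
rewrite /= wE enormZ ger0_norm ?invr_ge0// -/r mulVf ?gt_eqF// => /(_ (lexx _)).
move=> /le_trans /(_ (ch u x0 _ t01)); rewrite -hpE hu hx0 -!EFinM -EFinD lee_fin.
rewrite -(ler_pM2l r_gt0) => le_m.
have : r * (r^-1 * b + (1 - r^-1) * a) = b + (r - 1) * a by field; rewrite gt_eqF.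
nra.
Qed.

Definition prox_obj t h x u := (t%:E * h u + (enorm (u - x) ^+ 2 / 2)%:E)%E.

Lemma prox_obj_lsc t h x : 0 < t -> (forall u, h u != -oo%E) ->
  lower_semicontinuous h -> lower_semicontinuous (prox_obj t h x).
Proof.
move=> t0 hNy lsch u a; rewrite /prox_obj; set q := fun v => enorm (v - x) ^+ 2 / 2.
rewrite -/(q u) => lt_a.
have [b lt_bh lt_b] : exists2 b, (b%:E < h u)%E & a - t * b < q u.
  move: lt_a (hNy u); case: (h u) => [d| |]// + _.
    rewrite -EFinM -EFinD lte_fin => lt_a.
    exists (((a - q u) / t + d) / 2).
      rewrite lte_fin; suff : (a - q u) / t < d by lra.
      by rewrite ltr_pdivrMr//; lra.
    suff : t * (((a - q u) / t + d) / 2) = (a - q u + t * d) / 2 by lra.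
    by field; rewrite gt_eqF.
  move=> _; exists ((a - q u) / t + 1); first by rewrite ltry.
  suff : t * ((a - q u) / t + 1) = a - q u + t by lra.
  by field; rewrite gt_eqF.
have [V nV lt_V] := lsch u b lt_bh.
have cq : {for u, continuous q}.
  have -> : q = (fun v => enorm (v - x) * enorm (v - x) * 2^-1).
    by apply/funext => v; rewrite /q expr2.
  have ce := @continuous_enormB _ _ x u.
  by apply: continuousM; [exact: continuousM|exact: cst_continuous].
exists (V `&` [set v | a - t * b < q v]).
  by apply: filterI => //; exact: (cvgr_gt _ cq _ lt_b).
move=> v [/lt_V + /= lt_q]; move: (hNy v); case: (h v) => [d| |]// _.
  rewrite lte_fin => lt_bd; rewrite -EFinM -EFinD lte_fin.
  have : t * b < t * d by rewrite ltr_pM2l.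
  rewrite /q in lt_q *; lra.
by move=> _; rewrite gt0_muley ?lte_fin// addye// ltry.
Qed.

(** The quadratic term beats the linear minorant of [h], so a point that does
    at least as well as [x0] stays in a ball around [x0]. The radius grows
    with [t] but not with [1 / t], which keeps the proximal points bounded as
    [t] tends to [0]. *)
Lemma prox_obj_le_bounded h x0 a : proper_lsc_convex h -> h x0 = a%:E ->
  exists2 A, 0 <= A & forall t x u, 0 < t ->
    (prox_obj t h x u <= prox_obj t h x x0)%E ->
    enorm (u - x0) <= 2 * (enorm (x0 - x) + t * A) + 1.
Proof.
move=> plc hx0; have [A A0 minor] := proper_lsc_convex_minorant plc hx0.
exists A => // t x u t0; apply: contraTT; rewrite -!ltNge.
rewrite /prox_obj hx0; set r := enorm (u - x0); set d := enorm (x0 - x) => lt_r.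
have [[hNy _] _ _] := plc.
move: (hNy u) (minor u); case: (h u) => [b| |]// _; last first.
  by move=> _; rewrite gt0_muley ?lte_fin// addye// ltry.
rewrite lee_fin -/r => le_b; rewrite -!EFinM -!EFinD lte_fin.
have d0 : 0 <= d := enorm_ge0 _.
have tA0 : 0 <= t * A by rewrite mulr_ge0// ltW.
have tb : t * (a - A * (1 + r)) <= t * b by rewrite ler_pM2l.
have rd : r - d <= enorm (u - x).
  have := ler_enormD (u - x) (x - x0); rewrite subrKA -/r (enormBC x x0) -/d; lra.
have sq : (r - d) ^+ 2 <= enorm (u - x) ^+ 2.
  by rewrite ler_sqr ?nnegrE ?enorm_ge0//; lra.
have : 0 < r * (r / 2 - d - t * A - 1 / 2) by rewrite mulr_gt0//; lra.
nra.
Qed.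

(** By coercivity a minimizer over a large enough ball, which exists by
    compactness, is a minimizer over the whole space. *)
Lemma prox_argmin t h x : proper_lsc_convex h -> 0 < t ->
  argmin (prox_obj t h x) setT (prox t h x).
Proof.
move=> plc t0; have [[hNy [x0 hx0]] lsch _] := plc.
have /fineK/esym hx0E : h x0 \is a fin_num by rewrite fin_numE hNy lt_eqF.
have [A A0 bounded] := prox_obj_le_bounded plc hx0E.
set r := 2 * (enorm (x0 - x) + t * A) + 1 in bounded.
have x0K : enorm (x0 - x0) <= r.
  have tA0 : 0 <= t * A by rewrite mulr_ge0// ltW.
  by have := enorm_ge0 (x0 - x); rewrite subrr enorm0 /r; lra.
have [p [_ pmin]] := lsc_compact_argmin (@prox_obj_lsc t h x t0 hNy lsch)
  (@compact_eball _ _ x0 r) (ex_intro _ x0 x0K).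
apply: (@xgetPex _ 0 (argmin (prox_obj t h x) setT)); exists p; split=> // u _.
have [ux0|/ltW x0u] := leP (prox_obj t h x u) (prox_obj t h x x0).
  by apply: pmin; exact: bounded.
exact: le_trans (pmin _ x0K) x0u.
Qed.

Lemma prox_fin_num t h x : proper_lsc_convex h -> 0 < t ->
  h (prox t h x) \is a fin_num.
Proof.
move=> plc t0; have [[hNy [x0 hx0]] _ _] := plc.
have [_ /(_ x0 I)] := prox_argmin x plc t0; rewrite /prox_obj.
have /fineK <- : h x0 \is a fin_num by rewrite fin_numE hNy lt_eqF.
rewrite fin_numE hNy/=; apply: contraTN => /eqP ->.
by rewrite gt0_muley ?lte_fin// addye// -EFinM -EFinD -ltNge ltry.
Qed.

(** First-order optimality: compare the minimizer [p] with the point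
    [p + s (u - p)], bound [h] there by convexity, divide by [s] and let [s]
    tend to [0]. *)
Lemma prox_subgradient t h x : proper_lsc_convex h -> 0 < t ->
  subdifferential h (prox t h x) (t^-1 *: (x - prox t h x)).
Proof.
move=> plc t0 u; have [[hNy _] _ ch] := plc.
have [_ pmin] := prox_argmin x plc t0; have /fineK hpE := prox_fin_num x plc t0.
set p := prox t h x in pmin hpE *; set b := fine (h p) in hpE.
have := hNy u; case hu: (h u) => [a| |]// _; last by rewrite leey.
rewrite -hpE -EFinD lee_fin dotZl.
suff : t * (b - a) <= - dot (x - p) (u - p).
  rewrite -(ler_pM2l t0) => ?; suff : t * (b + t^-1 * dot (x - p) (u - p)) =
    t * b + dot (x - p) (u - p) by lra.
  by field; rewrite gt_eqF.
set N := enorm (u - p) ^+ 2; set d := dot (x - p) (u - p).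
have small s : 0 < s -> s <= 1 -> t * (b - a) <= - d + s * (N / 2).
  move=> s0 s1; have s01 : 0 <= s <= 1 by rewrite ltW.
  have := pmin (s *: u + (1 - s) *: p) I; rewrite /prox_obj -hpE.
  have := ch u p s s01; rewrite hu -hpE -!EFinM -!EFinD.
  case: (h _) (hNy (s *: u + (1 - s) *: p)) => [w| |]// _.
  rewrite -EFinM -EFinD !lee_fin => le_w.
  have -> : s *: u + (1 - s) *: p - x = (p - x) + s *: (u - p).
    by apply/rowP => i; rewrite !mxE; ring.
  rewrite (enormD_sqr (p - x)) dotZr enormZ exprMn real_normK ?num_real// -/N.
  rewrite -(opprB x p) dotNl -/d => le_obj.
  have tw : t * w <= t * (s * a + (1 - s) * b) by rewrite ler_pM2l.
  rewrite -(ler_pM2l s0); lra.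
apply/ler_addgt0Pr => e e0.
have N0 : 0 <= N := sqr_ge0 _.
pose s := Num.min 1 (e / (N / 2 + 1)).
have s0 : 0 < s by rewrite lt_min ltr01 divr_gt0//; lra.
rewrite (le_trans (small s s0 _)) ?ge_min ?lexx// lerD2l.
have : s <= e / (N / 2 + 1) by rewrite ge_min lexx orbT.
rewrite ler_pdivlMr; lra.
Qed.

End Prox.

(** * Existence of subgradients *)

Section SubgradientExistence.
Context {R : realType} {n : nat}.
Implicit Types (h : 'rV[R]_n -> \bar R).

Lemma subdifferential_fin_num h x : proper_function h ->
  subdifferential h x !=set0 -> h x \is a fin_num.
Proof.
move=> [hNy [x0 hx0]] [xi /(_ x0)]; rewrite fin_numE hNy/=.
by apply: contraTneq => ->; rewrite -ltNge addye.
Qed.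

(** The proximal points [p_t] of [x] stay in a bounded set as [t -> 0], so
    their subgradients [(x - p_t) / t] are bounded. Hence [p_t] tends to [x]
    and, by compactness, the subgradients have a cluster point; lower
    semicontinuity makes it a subgradient at [x]. Since [x] is arbitrary, the
    domain of [h] must be the whole space: near a boundary point of the
    domain, subgradients would be unbounded. *)
Lemma bounded_subgradients_neq0 h x : proper_lsc_convex h ->
  bounded_subgradients_on_bounded_sets h -> subdifferential h x !=set0.
Proof.
move=> plc bsg; have [[hNy [x0 hx0]] lsch _] := plc.
have /fineK/esym hx0E : h x0 \is a fin_num by rewrite fin_numE hNy lt_eqF.
have [A A0 bounded] := prox_obj_le_bounded plc hx0E.
have [M Mbound] := bsg _ (bounded_eball x0 (2 * (enorm (x0 - x) + A) + 1)).
pose t (m : nat) : R := m.+1%:R^-1.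
have t0 m : 0 < t m by rewrite invr_gt0 ltr0n.
have t1 m : t m <= 1 by rewrite invf_le1 ?ltr0n// ler1n.
pose p m := prox (t m) h x; pose xi m := (t m)^-1 *: (x - p m).
have xi_sub m : subdifferential h (p m) (xi m) by exact: prox_subgradient.
have xiM m : enorm (xi m) <= M.
  apply: (Mbound (p m)) => //=.
  have [_ /(_ x0 I) /(bounded _ _ _ (t0 m)) pm] := prox_argmin x plc (t0 m).
  by rewrite (le_trans pm)// lerD2r ler_pM2l// lerD2l ler_piMl.
have pE m : x - p m = t m *: xi m by rewrite scalerA divff ?gt_eqF// scale1r.
have [z [_ zcluster]] : [set u | enorm (u - 0) <= M] `&` cluster (xi @ \oo) !=set0.
  by apply: compact_eball; exists 0 => // m _; rewrite /= subr0.
exists z => y; have := hNy y; case hy: (h y) => [b| |]// _; last by rewrite leey.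
rewrite leNgt; apply/negP => lt_b.
set d := dot z (y - x) in lt_b.
have [e e0 lt_e] : exists2 e : R, 0 < e & ((b - d + e)%:E < h x)%E.
  move: lt_b (hNy x); case: (h x) => [a| |]// + _; last by exists 1; rewrite ?ltry.
  rewrite -EFinD lte_fin => lt_b; exists ((a + d - b) / 2); first lra.
  rewrite lte_fin; lra.
have [V nV lt_V] := lsch x _ lt_e.
have [r r0 rV] := nbhs_eballP nV.
have M0 : 0 <= M := le_trans (enorm_ge0 _) (xiM 0).
pose N := enorm (y - x); have N0 : 0 <= N := enorm_ge0 _.
have M1 : 0 < M + 1 by lra.
have N1 : 0 < N + 1 by lra.
have nearV : \forall m \near \oo, V (p m).
  near=> m; apply: rV; rewrite enormBC pE enormZ gtr0_norm//.
  have : t m < r / (M + 1).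
    by near: m; exact: (near_infty_natSinv_lt (PosNum (divr_gt0 r0 M1))).
  rewrite ltr_pdivlMr//; have := ler_wpM2l (ltW (t0 m)) (xiM m).
  by have := t0 m; lra.
(* A late enough index has its proximal point in [V] and its subgradient so
   near [z] that both errors together are below [e]. *)
have [] := zcluster [set u | exists2 m, V (p m) & u = xi m]
    [set u | enorm (u - z) < e / (N + 1)].
- by apply: filterS nearV => m Vm; exists m.
- by apply: nbhs_eball; exact: divr_gt0.
move=> _ [[m Vm ->] /=]; rewrite ltr_pdivlMr// => near_z.
have := xi_sub m y; have := lt_V _ Vm; rewrite hy.
case: (h (p m)) => [a| |]//; rewrite lte_fin -EFinD lee_fin => lt_a.
(* The displacement of the base point contributes [t |xi|^2], which has the
   favorable sign. *)
have -> : y - p m = (y - x) + t m *: xi m by rewrite -pE subrKA.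
rewrite dotDr dotZr; have := mulr_ge0 (ltW (t0 m)) (dot_ge0 (xi m)).
have := dot_le_enorm (z - xi m) (y - x).
rewrite dotBl -/d -/N (enormBC z).
have := enorm_ge0 (xi m - z); nra.
Unshelve. all: by end_near. Qed.

End SubgradientExistence.

(** * The proximal gradient inequality *)

Section ProximalGradient.
Context {R : realType} {n : nat}.
Implicit Types (s h : 'rV[R]_n -> R) (u v x y z : 'rV[R]_n) (b t : R).

(** The common source of both rates. Sum three estimates: the sufficient
    decrease bounds [s z] above by a quadratic model at [x], strong convexity
    bounds [s u] below by the linear model at [x], and [prox_subgradient]
    bounds [h u] below by a linear function at [z]. The gradient terms cancel
    and the inner products left over complete the squares. *)
Lemma prox_grad_inequality s h b t x u :
  differentiable s x -> strongly_convex b s ->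
  proper_lsc_convex (EFin \o h) -> 0 < t ->
  let z := prox_grad s (EFin \o h) t x in
  s z <= s x + dot (grad s x) (z - x) + t^-1 / 2 * enorm (z - x) ^+ 2 ->
  s z + h z <= s u + h u +
    t^-1 / 2 * (enorm (x - u) ^+ 2 - enorm (z - u) ^+ 2) - b / 2 * enorm (x - u) ^+ 2.
Proof.
move=> ds sc plc t0 z dec; have := strongly_convex_gradient_le u ds sc.
have := prox_subgradient (x - t *: grad s x) plc t0 u.
rewrite -/(prox_grad _ _ _ _) -/z /= lee_fin dotZl.
have -> : x - t *: grad s x - z = (x - z) - t *: grad s x by rewrite addrAC.
rewrite dotBl dotZl mulrBr mulrA mulVf ?gt_eqF// mul1r (enormBC u x).
have -> : x - u = (x - z) - (u - z) by rewrite opprB subrKA.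
have -> : enorm (z - u) = enorm (u - z) by rewrite enormBC.
rewrite [in X in t^-1 / 2 * (X - _)]enormB_sqr; move: dec; rewrite (enormBC z x).
have -> : dot (grad s x) (u - z) = dot (grad s x) (u - x) - dot (grad s x) (z - x).
  by rewrite -dotBr opprB subrKA.
lra.
Qed.

End ProximalGradient.

(** * Rates of real recursions *)

Section RealSequences.
Context {R : realType}.
Implicit Types (alpha C K q : R).

Lemma powR_le_tangent alpha (x : R) : 0 <= alpha <= 1 -> 0 < x ->
  x `^ alpha <= 1 + alpha * (x - 1).
Proof.
move=> /andP[a0 a1] x0.
have : expR (alpha * ln x + (1 - alpha) * 0) <=
    alpha * expR (ln x) + (1 - alpha) * expR 0.
  exact: (convex_expR (Itv01 a0 a1)).
rewrite expR0 lnK ?posrE// mulr0 addr0 /powR gt_eqF//; lra.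
Qed.

Lemma powR_ge1 alpha (x : R) : 0 <= alpha -> 1 <= x -> 1 <= x `^ alpha.
Proof. by move=> a0 x1; rewrite -(powRr0 x) ler_powR. Qed.

(** Concavity of the power bounds the increment by [alpha m^(alpha - 1)]. That it
    stays below [1] by the margin [1 - alpha] is what makes the induction of
    [recursion_rate] close. *)
Lemma powR_succ_le alpha (m : nat) : 0 <= alpha <= 1 -> (0 < m)%N ->
  m.+1%:R `^ alpha <= m%:R `^ alpha + alpha :> R.
Proof.
move=> /[dup] a01 /andP[a0 a1] m0; have mR : 0 < m%:R :> R by rewrite ltr0n.
have -> : m.+1%:R = m%:R * (1 + m%:R^-1) :> R.
  by rewrite mulrDr mulr1 divff ?gt_eqF// natr1.
have m1 : 0 < 1 + m%:R^-1 :> R by rewrite addr_gt0// invr_gt0.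
rewrite (powRM _ (ltW mR) (ltW m1)); have := powR_le_tangent a01 m1.
rewrite [1 + _ - 1]addrC addKr => le_t.
have s_le : m%:R `^ alpha <= m%:R :> R by rewrite ler1_powR// ler1n.
rewrite (le_trans (ler_wpM2l (powR_ge0 _ _) le_t))// mulrDr mulr1 lerD2l.
by rewrite mulrCA ler_piMr// ler_pdivrMr// mul1r.
Qed.

(** Let [s_j = j^alpha]. When [b_j s_j] is at the bound [K], the contraction by
    [1 - 1 / s_(j+1)] lowers it by [K / s_j], while passing from the scale [s_j]
    to [s_(j+1)] costs at most [alpha K / s_j] and the perturbation at most
    [C / s_j]; so the bound propagates as soon as [C <= (1 - alpha) K]. In the
    first step the weight of [b 0] vanishes, which starts the induction from
    an arbitrary [b 0]. *)
Lemma recursion_rate alpha C K (b : nat -> R) : 0 <= alpha <= 1 -> 0 <= K ->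
  C <= K * (1 - alpha) ->
  (forall j, b j.+1 <= (1 - j.+1%:R `^ (- alpha)) * b j +
    C * (j.+1%:R `^ (- alpha)) ^+ 2) ->
  forall j, b j.+1 * j.+1%:R `^ alpha <= K.
Proof.
move=> /[dup] a01 /andP[a0 a1] K0 CK rec; elim=> [|j IH].
  have := rec 0; rewrite !powR1 subrr mul0r add0r expr1n !mulr1.
  have : 0 <= K * alpha by rewrite mulr_ge0.
  lra.
have := rec j.+1; have := powR_succ_le a01 (ltn0Sn j); rewrite !powRN.
set s := j.+1%:R `^ alpha in IH *; set s' := j.+2%:R `^ alpha => s's.
have s0 : 0 < s by rewrite powR_gt0.
have ss' : s <= s' by rewrite ge0_ler_powR// ?nnegrE// ler_nat.
have s1 : 1 <= s by rewrite powR_ge1// ler1n.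
have s'0 : 0 < s' by lra.
rewrite -(ler_pM2r s'0) => /le_trans; apply.
have -> : ((1 - s'^-1) * b j.+1 + C * s'^-1 ^+ 2) * s' = (s' - 1) * b j.+1 + C / s'.
  by field; rewrite gt_eqF.
rewrite -(ler_pM2l s0) mulrDr.
have : s * (C / s') <= K * (1 - alpha).
  have K1 : 0 <= K * (1 - alpha) by rewrite mulr_ge0// subr_ge0.
  rewrite mulrA ler_pdivrMr// (le_trans (ler_wpM2l (ltW s0) CK))//.
  by rewrite mulrC ler_wpM2l.
have : (s' - 1) * (b j.+1 * s) <= (s' - 1) * K by rewrite ler_wpM2l//; lra.
have : K * (s' - alpha) <= K * s by rewrite ler_wpM2l//; lra.
lra.
Qed.

Lemma geometric_decay (e : nat -> R) q k m :
  (forall i, (i < m)%N -> e (k + i).+1 <= expR (- q) * e (k + i)%N) ->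
  e (k + m)%N <= expR (- (q * m%:R)) * e k.
Proof.
elim: m => [|m IH] dec; first by rewrite addn0 mulr0 oppr0 expR0 mul1r.
rewrite addnS (le_trans (dec m (ltnSn _)))//.
rewrite -natr1 mulrDr mulr1 opprD addrC expRD -mulrA ler_wpM2l ?expR_ge0//.
by apply: IH => i im; apply: dec; rewrite ltnS ltnW.
Qed.

Lemma step_sum_lower_bound alpha (k : nat) : 0 <= alpha <= 1 -> (0 < k)%N ->
  k%:R `^ (1 - alpha) / 2 <= (2 * k)%:R `^ (- alpha) * k%:R :> R.
Proof.
move=> /andP[a0 a1] k0; have kR : 0 < k%:R :> R by rewrite ltr0n.
rewrite natrM powRM// powRN -mulrA mulrC.
have -> : k%:R `^ (- alpha) * k%:R = k%:R `^ (1 - alpha) :> R.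
  by rewrite powRD ?(lt0r_neq0 kR) ?implybT// powRr1 ?ler0n// mulrC.
rewrite ler_wpM2r ?powR_ge0// lef_pV2 ?posrE ?powR_gt0//.
by rewrite ler1_powR// ler1n.
Qed.

End RealSequences.

(** * The bilevel algorithm *)

Section BiSG.
Context {R : realType} {n : nat}.
Implicit Types (f sigma psi s h : 'rV[R]_n -> R) (g : 'rV[R]_n -> \bar R)
  (u v x y z : 'rV[R]_n).

Lemma subdifferentialD_grad s h x xi : differentiable s x ->
  convex_function setT s -> subdifferential (EFin \o h) x xi ->
  subdifferential (EFin \o (s \+ h)) x (grad s x + xi).
Proof.
move=> ds cs hxi u; have := hxi u; rewrite /= !lee_fin dotDl.
by have := convex_gradient_le u ds cs; lra.
Qed.

Lemma subgradient_le h x xi (M : R) y : subdifferential (EFin \o h) x xi ->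
  enorm xi <= M -> h x - h y <= M * enorm (x - y).
Proof.
move=> /(_ y); rewrite /= lee_fin => sub xiM.
have := dot_le_enorm xi (x - y); rewrite -(opprB y x) dotNr opprB.
have := ler_wpM2r (enorm_ge0 (x - y)) xiM; lra.
Qed.

Lemma grad_map_bound s g t (M : R) y : 0 < t ->
  enorm (grad_map s g t y) <= M -> enorm (prox_grad s g t y - y) <= t * M.
Proof.
move=> t0; rewrite /grad_map enormZ gtr0_norm ?invr_gt0// enormBC.
by rewrite ler_pdivrMl.
Qed.

Lemma sufficient_decrease_lipschitz f g (Lf L : R) x :
  (forall y, differentiable f y) -> lipschitz_grad Lf f -> Lf <= L ->
  sufficient_decrease f g L x.
Proof.
move=> df fL LfL; rewrite /sufficient_decrease; set z := prox_grad _ _ _ _.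
rewrite (le_trans (descent_lemma x z df fL))// lerD2l ler_wpM2r ?sqr_ge0//.
by rewrite ler_pM2r.
Qed.

(** Backtracking stops at the latest once the trial constant reaches [Lf], by
    the descent lemma; the trial before the accepted one was therefore below
    [Lf], and the accepted one is below [Lf rho] unless no increase occurred. *)
Lemma stepsize_rule_bounds f g (Lf : R) xs (L : nat -> R) (Lbar : R) :
  (forall y, differentiable f y) -> 0 < Lf -> lipschitz_grad Lf f ->
  stepsize_rule f g Lf xs L Lbar ->
  forall k, [/\ 0 < L k, L k <= Lbar & sufficient_decrease f g (L k) (xs k)].
Proof.
move=> df Lf0 fL [[LE ->] k|[gamma [rho [gamma0 rho1 bt ->]]]].
  by rewrite LE; split=> //; exact: sufficient_decrease_lipschitz fL _.
set Lb := Num.max _ _; have rho0 : 0 < rho by lra.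
have step k : 0 < previous gamma L k <= Lb -> 0 < L k <= Lb.
  move=> /andP[p0 pL]; have [i [-> _ fail]] := bt k.
  rewrite mulr_gt0 ?exprn_gt0//=; case: i fail => [|i] fail; first by rewrite mulr1.
  rewrite exprSr mulrA le_max ler_pM2r//; apply/orP; left.
  rewrite leNgt; apply/negP => /ltW LfL; apply: (fail i) => //.
  exact: sufficient_decrease_lipschitz fL LfL.
have bounds k : 0 < L k <= Lb.
  elim: k => [|k IH]; apply: step => //=.
  by rewrite gamma0 le_max lexx orbT.
by move=> k; have /andP[? ?] := bounds k; have [i [_ ? _]] := bt k.
Qed.

Lemma outer_step_gt0 (c alpha : R) k : 0 < c -> 0 < outer_step c alpha k.
Proof. by move=> c0; rewrite mulr_gt0// powR_gt0. Qed.

Lemma outer_step_le (c alpha : R) k : c <= 1 ->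
  outer_step c alpha k <= k.+1%:R `^ (- alpha).
Proof. by move=> c1; rewrite ler_piMl// powR_ge0. Qed.

Lemma outer_step_le_c (c alpha : R) k : 0 < c -> 0 <= alpha ->
  outer_step c alpha k <= c.
Proof.
move=> c0 a0; rewrite /outer_step ler_piMr ?(ltW c0)// powRN invf_le1 ?powR_gt0//.
by rewrite powR_ge1// ler1n.
Qed.

(** ** Inner and outer estimates along the iterates *)

(** Here [h] is the real-valued form of the nonsmooth part of the inner
    objective. *)
Section Iterations.
Variables (f h sigma psi : 'rV[R]_n -> R) (Lsigma beta c alpha Lbar : R).
Variables (L : nat -> R) (xs ys : nat -> 'rV[R]_n) (x' : 'rV[R]_n) (D1 D2 : R).
Let F x := f x + h x.
Let omega x := sigma x + psi x.
Hypothesis f_convex : convex_function setT f.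
Hypothesis f_diff : forall x, differentiable f x.
Hypothesis h_plc : proper_lsc_convex (EFin \o h).
Hypothesis sigma_diff : forall x, differentiable sigma x.
Hypothesis sigma_lip : lipschitz_grad Lsigma sigma.
Hypothesis psi_plc : proper_lsc_convex (EFin \o psi).
Hypothesis sigma_strong : strongly_convex beta sigma.
Hypothesis alpha01 : 0 <= alpha <= 1.
Hypothesis c_gt0 : 0 < c.
Hypothesis c_le1 : c <= 1.
Hypothesis Lsigma_gt0 : 0 < Lsigma.
Hypothesis c_leL : c <= Lsigma^-1.
Hypothesis L_rule : forall k, [/\ 0 < L k, L k <= Lbar &
  sufficient_decrease f (EFin \o h) (L k) (xs k)].
Hypothesis xys : biSG f (EFin \o h) sigma psi c alpha L xs ys.
Hypothesis x'_min : forall y, F x' <= F y.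
Hypothesis D1_xs : forall k, enorm (xs k - x') <= D1.
Hypothesis D2_Omega : forall k,
  enorm (grad_map sigma (EFin \o psi) (outer_step c alpha k) (ys k)) <= D2.

Let eta k := outer_step c alpha k.

Lemma inner_step k u :
  F (ys k) <= F u + L k / 2 * (enorm (xs k - u) ^+ 2 - enorm (ys k - u) ^+ 2).
Proof.
have [-> _] := xys k; have [Lk0 _] := L_rule k.
rewrite /sufficient_decrease /= -{3}[L k]invrK => dec.
have Lk0' : 0 < (L k)^-1 by rewrite invr_gt0.
have := prox_grad_inequality u (f_diff (xs k)) (convex_strongly_convex0 f_convex)
  h_plc Lk0' dec.
by rewrite invrK !mul0r subr0.
Qed.

Lemma ys_fejer k : enorm (ys k - x') <= enorm (xs k - x').
Proof.
have [Lk0 _ _] := L_rule k.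
rewrite -ler_sqr ?nnegrE ?enorm_ge0// -subr_ge0.
have L2 : 0 < L k / 2 by rewrite divr_gt0.
rewrite -(pmulr_rge0 _ L2); have := inner_step k x'; have := x'_min (ys k); lra.
Qed.

Lemma xsS_sub_ys k : enorm (xs k.+1 - ys k) <= eta k * D2.
Proof.
by have [_ ->] := xys k; apply: grad_map_bound; [exact: outer_step_gt0|].
Qed.

Lemma inner_objective_convex x y (t : R) : 0 <= t <= 1 ->
  F (t *: x + (1 - t) *: y) <= t * F x + (1 - t) * F y.
Proof.
move=> t01; have [_ _ /(_ x y t t01)] := h_plc.
rewrite /= -!EFinM -EFinD lee_fin.
have := convex_strongly_convex0 f_convex x y t01; rewrite /F; lra.
Qed.

(** Compare [y^(j+1)] with the point at fraction [w] of the way from [y^j] to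
    [x']: convexity contracts the gap by [1 - w], and since [x^(j+1)] is within
    [eta_j D2 <= w D2] of [y^j] and within [D1] of [x'], it is within
    [w (D1 + D2)] of that point. Choosing [w] of the order of the outer step
    balances the two contributions. *)
Lemma inner_recursion j :
  let w := j.+1%:R `^ (- alpha) in
  F (ys j.+1) - F x' <= (1 - w) * (F (ys j) - F x') +
    Lbar / 2 * (D1 + D2) ^+ 2 * w ^+ 2.
Proof.
set w := _ `^ _ => /=; have w0 : 0 < w by rewrite powR_gt0.
have w1 : w <= 1.
  by have := outer_step_le_c j ltr01 (proj1 (andP alpha01)); rewrite /outer_step mul1r.
have w01 : 0 <= w <= 1 by rewrite (ltW w0).
set u := w *: x' + (1 - w) *: ys j.
have := inner_step j.+1 u; have := inner_objective_convex x' (ys j) w01; rewrite -/u.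
have [Lk0 LkL _] := L_rule j.+1.
have D20 : 0 <= D2 := le_trans (enorm_ge0 _) (D2_Omega 0).
have dist : enorm (xs j.+1 - u) <= w * (D1 + D2).
  have -> : xs j.+1 - u = w *: (xs j.+1 - x') + (1 - w) *: (xs j.+1 - ys j).
    by apply/rowP => i; rewrite !mxE; ring.
  rewrite (le_trans (ler_enormD _ _))// !enormZ !ger0_norm ?subr_ge0 ?(ltW w0)// mulrDr.
  rewrite lerD ?ler_wpM2l ?(ltW w0)//.
  rewrite (le_trans (ler_piMl _ _)) ?enorm_ge0 ?gerBl ?(ltW w0)//.
  rewrite (le_trans (xsS_sub_ys j))// ler_wpM2r//; exact: outer_step_le.
have : L j.+1 / 2 * enorm (xs j.+1 - u) ^+ 2 <= Lbar / 2 * (w * (D1 + D2)) ^+ 2.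
  rewrite ler_pM ?sqr_ge0 ?divr_ge0 ?(ltW Lk0) ?ler_pM2r//.
  by rewrite ler_sqr ?nnegrE ?enorm_ge0// (le_trans (enorm_ge0 _) dist).
have : 0 <= L j.+1 / 2 * enorm (ys j.+1 - u) ^+ 2.
  by rewrite mulr_ge0 ?sqr_ge0 ?divr_ge0 ?(ltW Lk0).
rewrite exprMn; lra.
Qed.

Lemma inner_rate (H : R) k : 0 <= H -> Lbar * (D1 + D2) ^+ 2 = H * (1 - alpha) ->
  F (ys k.+1) - F x' <= 2 * H / k.+1%:R `^ alpha.
Proof.
move=> H0 HE; rewrite ler_pdivlMr ?powR_gt0//.
apply: (@recursion_rate _ alpha (Lbar / 2 * (D1 + D2) ^+ 2) (2 * H)
  (fun k => F (ys k) - F x')) => //; last exact: inner_recursion.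
  by rewrite mulr_ge0.
suff : 0 <= H * (1 - alpha) by lra.
by rewrite mulr_ge0// subr_ge0 (proj2 (andP alpha01)).
Qed.

(** As long as the outer objective is above its value at [x'], the proximal
    gradient inequality for [sigma + psi] leaves only the contraction by
    [1 - beta eta] due to strong convexity; the inner step does not increase the
    distance to [x']. Bounding the factor by an exponential avoids asking that
    it be nonnegative. *)
Lemma outer_contraction k : omega x' <= omega (xs k.+1) ->
  enorm (xs k.+1 - x') ^+ 2 <= expR (- (beta * eta k)) * enorm (xs k - x') ^+ 2.
Proof.
have eta0 : 0 < eta k by exact: outer_step_gt0.
have dec := sufficient_decrease_lipschitz (EFin \o psi) (ys k) sigma_diff sigma_lip.
have : Lsigma <= (eta k)^-1.
  rewrite -[Lsigma]invrK lef_pV2 ?posrE ?invr_gt0//.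
  by rewrite (le_trans (outer_step_le_c _ _ _))// (proj1 (andP alpha01)).
move=> /dec; rewrite /sufficient_decrease /= invrK.
move=> /(prox_grad_inequality x' (sigma_diff _) sigma_strong psi_plc eta0).
have [_ <-] := xys k; rewrite -!/(omega _) => ineq mono.
have le1 : enorm (xs k.+1 - x') ^+ 2 <= (1 - beta * eta k) * enorm (ys k - x') ^+ 2.
  have : 0 <= (eta k)^-1 / 2 * (enorm (ys k - x') ^+ 2 - enorm (xs k.+1 - x') ^+ 2) -
      beta / 2 * enorm (ys k - x') ^+ 2 by lra.
  rewrite -(pmulr_rge0 _ eta0); set X := enorm _ ^+ 2; set Y := enorm _ ^+ 2.
  suff -> : eta k * ((eta k)^-1 / 2 * (X - Y) - beta / 2 * X) =
    (X - Y) / 2 - beta * eta k * X / 2 by lra.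
  by field; rewrite gt_eqF.
have := expR_ge1Dx (- (beta * eta k)) => /(ler_wpM2r (sqr_ge0 (enorm (ys k - x')))).
move=> /(le_trans le1) /le_trans; apply; rewrite ler_wpM2l ?expR_ge0//.
by rewrite ler_sqr ?nnegrE ?enorm_ge0// ys_fejer.
Qed.

(** The [k] steps from [k] to [2k] all have length at least [c (2k)^(-alpha)],
    and together at least [c k^(1-alpha) / 2]. *)
Lemma outer_rate k : 0 < beta -> (0 < k)%N ->
  (forall j, (k < j <= 2 * k)%N -> omega x' <= omega (xs j)) ->
  enorm (xs (2 * k)%N - x') <= expR (- (c * beta / 4 * k%:R `^ (1 - alpha))) * D1.
Proof.
move=> beta0 k0 above; have D10 : 0 <= D1 := le_trans (enorm_ge0 _) (D1_xs 0).
set a := c * beta / 4 * _; pose q := beta * (c * (2 * k)%:R `^ (- alpha)).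
have decay : enorm (xs (2 * k)%N - x') ^+ 2 <=
    expR (- (q * k%:R)) * enorm (xs k - x') ^+ 2.
  rewrite mul2n -addnn.
  apply: (@geometric_decay _ (fun i => enorm (xs i - x') ^+ 2)) => i ik.
  have ik2 : ((k + i).+1 <= 2 * k)%N by rewrite mul2n -addnn -addnS leq_add2l.
  have lt_k : (k < (k + i).+1)%N by rewrite ltnS leq_addr.
  rewrite (le_trans (outer_contraction (above _ _)))//; first by rewrite lt_k.
  rewrite ler_wpM2r ?sqr_ge0// ler_expR lerN2 ler_wpM2l ?(ltW beta0)//.
  rewrite ler_wpM2l ?(ltW c_gt0)// !powRN lef_pV2 ?posrE ?powR_gt0 ?ltr0n ?muln_gt0//.
  by rewrite ge0_ler_powR ?nnegrE ?ler_nat// (proj1 (andP alpha01)).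
have qk : 2 * a <= q * k%:R.
  have cb : 0 <= c * beta by rewrite mulr_ge0 ?ltW.
  have := ler_wpM2l cb (@step_sum_lower_bound R _ _ alpha01 k0).
  rewrite /a /q; lra.
rewrite -ler_sqr ?nnegrE ?enorm_ge0 ?mulr_ge0 ?expR_ge0//.
rewrite (le_trans decay)// exprMn -expRM_natl ler_pM ?expR_ge0 ?sqr_ge0//.
  by rewrite ler_expR mulrN lerN2.
by rewrite ler_sqr ?nnegrE ?enorm_ge0.
Qed.

(** The optimality condition of the proximal step that produces [x^(k+1)]
    supplies a subgradient, so that the assumed bound on subgradients of the
    outer objective applies to something. *)
Lemma xsS_omega_subgradient k :
  convex_function setT sigma ->
  subdifferential (EFin \o (sigma \+ psi)) (xs k.+1) !=set0.
Proof.
move=> sigma_convex; have [_ ->] := xys k; eexists.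
apply: subdifferentialD_grad => //.
by apply: prox_subgradient => //; exact: outer_step_gt0.
Qed.

End Iterations.

End BiSG.

(** * Convergence rates *)

Theorem theorem4 (R : realType) (n : nat)
  (f : 'rV[R]_n -> R) (g : 'rV[R]_n -> \bar R) (sigma psi : 'rV[R]_n -> R)
  (phi : 'rV[R]_n -> \bar R) (omega : 'rV[R]_n -> R)
  (Lf Lsigma beta c alpha : R)
  (L : nat -> R) (Lbar : R) (xs ys : nat -> 'rV[R]_n)
  (x' : 'rV[R]_n) (D1 D2 D H : R)
  (* inner problem *)
  (f_convex : convex_function setT f)
  (f_C1 : continuously_differentiable f)
  (Lf_gt0 : 0 < Lf) (f_lip : lipschitz_grad Lf f)
  (g_plc : proper_lsc_convex g)
  (phiE : forall x, phi x = ((f x)%:E + g x)%E)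
  (Xstar_neq0 : argmin phi setT !=set0)
  (* outer problem *)
  (omegaE : forall x, omega x = sigma x + psi x)
  (omega_convex : convex_function setT omega)
  (omega_coercive : coercive omega)
  (sigma_convex : convex_function setT sigma)
  (sigma_C1 : continuously_differentiable sigma)
  (Lsigma_gt0 : 0 < Lsigma) (sigma_lip : lipschitz_grad Lsigma sigma)
  (psi_plc : proper_lsc_convex (EFin \o psi))
  (* additional assumptions *)
  (beta_gt0 : 0 < beta) (sigma_strong : strongly_convex beta sigma)
  (g_bsg : bounded_subgradients_on_bounded_sets g)
  (* algorithm *)
  (alpha_itv : 2^-1 < alpha < 1)
  (c_gt0 : 0 < c) (c_le : c <= Num.min Lsigma^-1 1)
  (L_rule : stepsize_rule f g Lf xs L Lbar)
  (xys : biSG f g sigma psi c alpha L xs ys)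
  (* constants *)
  (x'_opt : argmin omega (argmin phi setT) x')
  (D1_gt0 : 0 < D1) (D2_gt0 : 0 < D2)
  (D1_xs : forall k, enorm (xs k - x') <= D1)
  (D2_Omega : forall k,
     enorm (grad_map sigma (EFin \o psi) (outer_step c alpha k) (ys k)) <= D2)
  (D2_omega_ys : forall k xi,
     subdifferential (EFin \o omega) (ys k) xi -> enorm xi <= D2)
  (D2_omega_xs : forall k xi, (1 <= k)%N ->
     subdifferential (EFin \o omega) (xs k) xi -> enorm xi <= D2)
  (D2_phi_xs : forall k xi, (1 <= k)%N ->
     subdifferential phi (xs k) xi -> enorm xi <= D2)
  (DE : D = D1 + D2) (HE : H = D ^+ 2 * Lbar / (1 - alpha)) :
  forall k : nat, (1 <= k)%N ->
  forall kt : nat,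
    argmin (fun j => omega (xs j)) [set j | (k.+1 <= j <= 2 * k)%N] kt ->
    (phi (xs kt) - phi x' <= ((2 * H + D ^+ 2) / k%:R `^ alpha)%:E)%E /\
    omega (xs kt) - omega x' <=
      (expR (c * beta / 4))^-1 `^ (k%:R `^ (1 - alpha)) * D ^+ 2.

Proof.
(* The inner objective is real-valued, so all estimates can be made in [R]. *)
have g_fin x : g x \is a fin_num.
  have [gp _ _] := g_plc; apply: (subdifferential_fin_num gp).
  exact: bounded_subgradients_neq0.
pose h x := fine (g x).
have gE : g = EFin \o h by apply/funext => x; rewrite /= fineK.
have phiEh : phi = EFin \o (f \+ h).
  by apply/funext => x; rewrite phiE gE.
have omegaEs : omega = sigma \+ psi by apply/funext.
have [a_gt a_lt] := andP alpha_itv.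
have alpha01 : 0 <= alpha <= 1 by apply/andP; split; lra.
have [f_diff _] := f_C1; have [sigma_diff _] := sigma_C1.
have [c_leL c_le1] : c <= Lsigma^-1 /\ c <= 1.
  by move: c_le; rewrite le_min => /andP.
have L_bounds := stepsize_rule_bounds f_diff Lf_gt0 f_lip L_rule.
have Lbar_gt0 : 0 < Lbar by have [L0 /(lt_le_trans L0)] := L_bounds 0.
have [[_ x'_min] _] := x'_opt.
have {}x'_min y : f x' + h x' <= f y + h y.
  by have := x'_min y I; rewrite phiEh /= lee_fin.
have H_ge0 : 0 <= H.
  rewrite HE; apply: divr_ge0; last by lra.
  by apply: mulr_ge0; [exact: sqr_ge0|exact: ltW].
rewrite gE in g_plc g_bsg L_bounds xys.
move=> k k_gt0 kt [/= /andP[lt_k kt_le] kt_min].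
case: kt lt_k kt_le kt_min => [//|j] lt_k kt_le kt_min.
have k_pow : 0 < k%:R `^ alpha :> R by rewrite powR_gt0 ?ltr0n.
split.
  case: j lt_k {kt_le kt_min} => [|j] lt_k; first by rewrite ltnS leqNgt k_gt0 in lt_k.
  set i := j.+1 in lt_k *.
  have k_le (m : nat) : (k <= m)%N -> (m%:R `^ alpha)^-1 <= (k%:R `^ alpha)^-1 :> R.
    move=> km; have m0 := leq_trans k_gt0 km.
    rewrite lef_pV2 ?posrE ?powR_gt0 ?ltr0n// ge0_ler_powR ?nnegrE ?ler_nat//.
    by have /andP[] := alpha01.
  rewrite phiEh /= -EFinB lee_fin.
  have inner : f (ys i) + h (ys i) - (f x' + h x') <= 2 * H / k%:R `^ alpha.
    have HE' : Lbar * (D1 + D2) ^+ 2 = H * (1 - alpha).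
      by rewrite HE DE; field; rewrite subr_eq0 gt_eqF.
    have := inner_rate f_convex f_diff g_plc alpha01 c_gt0 c_le1 L_bounds xys
      D1_xs D2_Omega j H_ge0 HE'.
    move=> /le_trans; apply; rewrite ler_wpM2l ?mulr_ge0//.
    exact: k_le.
  have move_le : f (xs i.+1) + h (xs i.+1) - (f (ys i) + h (ys i)) <=
      D ^+ 2 / k%:R `^ alpha.
    have [xi hxi] := bounded_subgradients_neq0 (xs i.+1) g_plc g_bsg.
    have phi_xi := subdifferentialD_grad (f_diff _) f_convex hxi.
    have xi_le : enorm (grad f (xs i.+1) + xi) <= D2.
      by apply: (D2_phi_xs i.+1) => //; rewrite phiEh.
    rewrite (le_trans (subgradient_le (ys i) phi_xi xi_le))//.
    have := xsS_sub_ys c_gt0 xys D2_Omega i => /(ler_wpM2l (ltW D2_gt0)) /le_trans.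
    apply; have := outer_step_le alpha i c_le1; rewrite powRN.
    move=> /le_trans /(_ (k_le _ (ltnW lt_k))) eta_le.
    have -> : D2 * (outer_step c alpha i * D2) = D2 ^+ 2 * outer_step c alpha i by ring.
    apply: ler_pM => //; [exact: sqr_ge0|exact/ltW/outer_step_gt0|].
    by rewrite ler_sqr ?nnegrE; lra.
  rewrite mulrDl; lra.
set E := _ `^ _ * _.
have E_ge0 : 0 <= E by rewrite mulr_ge0 ?powR_ge0 ?sqr_ge0.
(* If the best value on the window is not above the optimal value there is
   nothing to prove; otherwise every iterate of the window is above it. *)
have [le_om|/ltW ge_om] := leP (omega (xs j.+1)) (omega x').
  by rewrite (le_trans _ E_ge0)// subr_le0.
have above i : (k < i <= 2 * k)%N -> sigma x' + psi x' <= sigma (xs i) + psi (xs i).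
  by move=> /kt_min; rewrite -!omegaE; exact: le_trans.
have k2 : (k < 2 * k <= 2 * k)%N.
  by rewrite leqnn andbT mul2n -addnn -{1}[k]addn0 ltn_add2l.
rewrite (le_trans (lerB (kt_min _ k2) (lexx _)))//.
have rate := outer_rate f_convex f_diff g_plc sigma_diff sigma_lip psi_plc sigma_strong
  alpha01 c_gt0 Lsigma_gt0 c_leL L_bounds xys x'_min D1_xs beta_gt0 k_gt0 above.
have k2E : (2 * k = (2 * k).-1.+1)%N by rewrite prednK// muln_gt0.
have [xi xi_sub] : subdifferential (EFin \o (sigma \+ psi)) (xs (2 * k)%N) !=set0.
  by rewrite k2E; exact: (xsS_omega_subgradient sigma_diff psi_plc c_gt0 xys).
have xi_le : enorm xi <= D2.
  by apply: (D2_omega_xs (2 * k)%N); rewrite ?muln_gt0// omegaEs.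
have := subgradient_le x' xi_sub xi_le; rewrite omegaEs => /le_trans; apply.
rewrite (le_trans (ler_wpM2l (ltW D2_gt0) rate))// /E -expRN -expRM mulNr.
rewrite mulrCA ler_wpM2l ?expR_ge0// DE.
have := sqr_ge0 D1; have := sqr_ge0 D2; have := mulr_gt0 D1_gt0 D2_gt0.
lra.
Qed.
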